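(* Let $N\ge 1$ be an integer and let $z_1,\dots,z_N\in\mathbb{C}$ with $|z_j|<1$ for $1\le j\le N$. Then $$\prod_{j=1}^{N}\frac{1}{1-z_j}=1+\sum_{j=1}^{N}\frac{h_j(z_j,z_{j+1},\dots,z_N)}{(1-z_1)(1-z_2)\cdots(1-z_j)},$$ where, for $1\le j\le N$, $$h_j(z_j,z_{j+1},\dots,z_N):=\sum_{\substack{0\le \beta_j,\beta_{j+1},\dots,\beta_N\le j\\ \sum_{k=j}^{N}\beta_k=j}}\ \prod_{k=j}^{N}z_k^{\beta_k}$$ is the complete homogeneous symmetric polynomial of degree $j$ in the variables $z_j,z_{j+1},\dots,z_N$.
   Context: The indices $\beta_j,\dots,\beta_N$ in the sum range over integers, and $0^0=1$. *)

(* Defs.v *)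
From HB Require Import structures.
From mathcomp Require Import all_boot all_order all_algebra.
From mathcomp Require Import reals complex.

Set Implicit Arguments.
Unset Strict Implicit.
Unset Printing Implicit Defensive.

Import Order.TTheory GRing.Theory Num.Theory.
Local Open Scope ring_scope.

(* [h_sym z N j] is h_j(z_j, ..., z_N) for 1 <= j <= N.  The N.+1 - j exponents
   beta_j, ..., beta_N are stored from 0: [b i] is beta_(j + i). *)
Definition h_sym (R : realType) (z : nat -> R[i]) (N j : nat) : R[i] :=
  \sum_(b : {ffun 'I_(N.+1 - j) -> 'I_j.+1} | (\sum_(i < N.+1 - j) b i)%N == j)
    \prod_(i < N.+1 - j) z (j + i)%N ^+ b i.

(* Main.v *)
Require Import Defs.
From HB Require Import structures.
From mathcomp Require Import all_boot all_order all_algebra.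
From mathcomp Require Import reals complex ring.

Set Implicit Arguments.
Unset Strict Implicit.
Unset Printing Implicit Defensive.

Import Order.TTheory GRing.Theory Num.Theory.
Local Open Scope ring_scope.

(** Let [G_j] be the part of degree at least [j] of the power series
    [prod_(k >= j) 1 / (1 - z_k)], that is, the sum of [h_e (z_j, ..., z_N)] over
    [e >= j].  Multiplying [G_j] by [1 - z_j] removes the variable [z_j] and
    leaves [G_(j+1)] plus the single term [h_j (z_j, ..., z_N)].  Dividing by
    [(1 - z_1) ... (1 - z_j)], one sees that the [j]-th summand of the theorem is
    the difference of two consecutive values of
    [G_j / ((1 - z_1) ... (1 - z_(j-1)))], so the sum telescopes.  The first
    value [G_1] is the product minus its constant term [1]; the last one is [0],
    because [G_(N+1)] involves positive degrees only, in no variable.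

    No series has to be summed: [G_j] is written as the finite product minus
    the finitely many terms of low degree ([tail_part]), and its behaviour
    ([tail_part_cons]) follows from the recurrence
    [h_(d+1) (x, s) = h_(d+1) (s) + x h_d (x, s)] ([complete_hom_consS]).  The
    divisions are legitimate because [|z_j| < 1] excludes [z_j = 1].  The
    description of [h_d] by exponent vectors is the expansion of a product of
    truncated geometric series ([sum_monomials_coef]). *)

Section CompleteHomogeneous.
Variable F : comNzRingType.
Implicit Types (x : F) (s : seq F) (d n : nat).

Definition geom_poly n x : {poly F} := \poly_(k < n.+1) x ^+ k.

(** The truncation order equals the degree that is read off, the least
    order for which no monomial of degree [d] is lost. *)
Definition complete_hom s d : F := (\prod_(x <- s) geom_poly d x)`_d.

(** A coefficient of a product depends only on coefficients of lower or equal
    index in the factors, so truncating later than [d] changes nothing. *)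
Lemma coef_prod_geom n s d :
  (d <= n)%N -> (\prod_(x <- s) geom_poly n x)`_d = complete_hom s d.
Proof.
(* The degree read off decreases in the induction: it is separated from the
   truncation order [m] on the right-hand side. *)
rewrite /complete_hom => le_dn; move: (leqnn d).
move: {2 4}d => m; elim: s d le_dn => [|x s IHs] d le_dn le_dm.
  by rewrite !big_nil.
rewrite !big_cons !coefM; apply: eq_bigr => -[k /=]; rewrite ltnS => le_kd _.
rewrite !coef_poly !ltnS (leq_trans le_kd le_dn) (leq_trans le_kd le_dm).
by rewrite IHs // (leq_trans (leq_subr k d)).
Qed.

Lemma complete_hom0 s : complete_hom s 0 = 1.
Proof.
rewrite /complete_hom; elim: s => [|x s IHs]; first by rewrite big_nil coefC.
by rewrite big_cons coef0M IHs coef_poly mulr1.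
Qed.

Lemma complete_hom_nilS d : complete_hom [::] d.+1 = 0.
Proof. by rewrite /complete_hom big_nil coefC. Qed.

Lemma complete_hom_cons x s d :
  complete_hom (x :: s) d = \sum_(k < d.+1) x ^+ k * complete_hom s (d - k).
Proof.
rewrite /complete_hom big_cons coefM; apply: eq_bigr => k _.
by rewrite coef_poly ltn_ord coef_prod_geom ?leq_subr.
Qed.

(** A monomial of degree [d + 1] either avoids [x] or is [x] times a monomial
    of degree [d]. *)
Lemma complete_hom_consS x s d :
  complete_hom (x :: s) d.+1
  = complete_hom s d.+1 + x * complete_hom (x :: s) d.
Proof.
rewrite !complete_hom_cons big_ord_recl expr0 mul1r subn0; congr (_ + _).
by rewrite mulr_sumr; apply: eq_bigr => k _; rewrite exprS mulrA subSS.
Qed.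

(** Expanding the product of truncated geometric series gives one monomial per
    exponent vector [b], in degree the sum of the [b i]. *)
Lemma sum_monomials_coef m d (y : nat -> F) :
  \sum_(b : {ffun 'I_m -> 'I_d.+1} | (\sum_(i < m) b i)%N == d)
     \prod_(i < m) y i ^+ b i
  = (\prod_(i < m) geom_poly d (y i))`_d.
Proof.
under [in RHS]eq_bigr do rewrite /geom_poly poly_def.
rewrite bigA_distr_bigA coef_sum big_mkcond; apply: eq_bigr => b _.
rewrite scaler_prod prodrXr coefZ coefXn eq_sym.
by case: eqP => _; rewrite ?mulr1 ?mulr0.
Qed.

End CompleteHomogeneous.

Lemma h_symE (R : realType) (z : nat -> R[i]) N j :
  h_sym z N j = complete_hom [seq z k | k <- index_iota j N.+1] j.
Proof.
rewrite /h_sym (sum_monomials_coef _ _ (fun i => z (j + i)%N)).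
rewrite /complete_hom big_map -[X in index_iota X]add0n big_addn big_mkord.
by under [in RHS]eq_bigr do rewrite addnC.
Qed.

Section Tails.
Variable F : fieldType.
Implicit Types (x : F) (s : seq F) (d : nat).

(** The part of degree at least [d] of the series [prod_(x <- s) 1 / (1 - x)]. *)
Definition tail_part s d : F :=
  \prod_(x <- s) (1 / (1 - x)) - \sum_(e < d) complete_hom s e.

Lemma tail_part_nilS d : tail_part [::] d.+1 = 0.
Proof.
rewrite /tail_part big_nil big_ord_recl complete_hom0.
by rewrite big1 ?addr0 ?subrr // => e _; rewrite complete_hom_nilS.
Qed.

(** Multiplying by [1 - x] turns the terms of degree below [d] in [x :: s] into
    those in [s], except that the truncation leaves the uncancelled term
    [- x * complete_hom (x :: s) (d - 1)].  By the recurrence this is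
    [complete_hom s d - complete_hom (x :: s) d], a form that also makes sense
    for [d = 0]. *)
Lemma sum_complete_hom_cons x s d :
  (1 - x) * \sum_(e < d) complete_hom (x :: s) e
  = \sum_(e < d.+1) complete_hom s e - complete_hom (x :: s) d.
Proof.
elim: d => [|d IHd]; first by rewrite big_ord0 big_ord1 !complete_hom0 mulr0 subrr.
rewrite big_ord_recr mulrDr IHd [in RHS]big_ord_recr complete_hom_consS /=.
by ring.
Qed.

(** The telescoping step: dropping the variable [x] and raising the degree bound
    together cost exactly one homogeneous term, because the two boundary terms
    combine by the recurrence. *)
Lemma tail_part_cons x s d : 1 - x != 0 ->
  tail_part (x :: s) d = (tail_part s d.+1 + complete_hom (x :: s) d) / (1 - x).
Proof.
move=> nz; apply: (canRL (mulfK nz)); rewrite mulrC /tail_part mulrBr.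
rewrite sum_complete_hom_cons big_cons mulrA mulrCA mulfV // !mulr1 mul1r.
by rewrite opprB addrA addrAC.
Qed.

End Tails.

Theorem theorem4p4 (R : realType) (N : nat) (z : nat -> R[i])
    (hN : (1 <= N)%N)
    (hz : forall j : nat, (1 <= j <= N)%N -> `|z j| < 1) :
  \prod_(1 <= j < N.+1) (1 / (1 - z j)) =
  1 + \sum_(1 <= j < N.+1) (h_sym z N j / \prod_(1 <= k < j.+1) (1 - z k)).
Proof.
have nz k : (1 <= k <= N)%N -> 1 - z k != 0.
  move=> /hz ltz; rewrite subr_eq0; apply/eqP => z1.
  by rewrite -z1 normr1 ltxx in ltz.
pose vars j := [seq z k | k <- index_iota j N.+1].
have vars_cons j : (j <= N)%N -> vars j = z j :: vars j.+1.
  by move=> le_jN; rewrite /vars /index_iota subSn.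
pose tail j := tail_part (vars j) j / \prod_(1 <= k < j) (1 - z k).
have step j : (1 <= j < N.+1)%N ->
    h_sym z N j / \prod_(1 <= k < j.+1) (1 - z k) = - tail j.+1 - - tail j.
  move=> /andP[j_gt0 le_jN]; have nzj : 1 - z j != 0 by rewrite nz ?j_gt0.
  rewrite h_symE /tail -/(vars j) vars_cons // tail_part_cons //.
  rewrite big_nat_recr //= invfM; by ring.
rewrite (telescope_sumr_eq (fun j => - tail j)) // opprK /tail.
have -> : vars N.+1 = [::] by rewrite /vars /index_iota subnn.
rewrite tail_part_nilS mul0r oppr0 add0r (@big_geq _ _ _ 1 1) // divr1.
by rewrite /tail_part big_ord1 complete_hom0 addrC subrK big_map.
Qed.
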